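(* For any integers $p,q\ge 0$ and $m,n\ge 1$, the poset $\mathbf{p}\oplus(\mathbf{m}\times\mathbf{n})\oplus\mathbf{q}$ is a nice distributive lattice.
   Context: $\mathbf{m}$ denotes the $m$-element chain ($\mathbf{0}$ is empty) and $\mathbf{m}\times\mathbf{n}$ the product poset. For posets $P,Q$, $P\oplus Q$ (called the direct sum in the paper) is the poset on the disjoint union of $P$ and $Q$ keeping the orders of $P$ and $Q$ and declaring every element of $P$ below every element of $Q$. A chain partition of a finite poset is a partition of it into chains; its type is the partition formed by the block sizes in weakly decreasing order. For partitions of the same integer, $\mu\unlhd\nu$ means $\sum_{i\le k}\mu_i\le\sum_{i\le k}\nu_i$ for all $k$. A poset $P$ is nice if whenever $P$ has a chain partition of type $\lambda$, it also has one of type $\mu$ for every $\mu\unlhd\lambda$. *)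

(* Defs.v *)
From HB Require Import structures.
From mathcomp Require Import all_boot all_order.

Set Implicit Arguments.
Unset Strict Implicit.
Unset Printing Implicit Defensive.

Import Order.Theory.

Local Open Scope order_scope.

(* The ordinal sum P (+) Q, with every element of P below every element of Q. *)

Definition dsum_type d1 d2 (P : finPOrderType d1) (Q : finPOrderType d2)
  : Type := (P + Q)%type.

Notation "P \oplus Q" := (dsum_type P Q)
  (at level 50, left associativity) : type_scope.

Fact dsum_display (d1 d2 : Order.disp_t) : Order.disp_t.
Proof. exact: Order.Disp tt tt. Qed.

Section DirectSum.
Variables (d1 d2 : Order.disp_t).
Variables (P : finPOrderType d1) (Q : finPOrderType d2).

HB.instance Definition _ := Finite.copy (P \oplus Q) (P + Q)%type.

Definition dsum_le : rel (P \oplus Q) := fun u v =>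
  match u, v with
  | inl x, inl y => x <= y
  | inr x, inr y => x <= y
  | inl _, inr _ => true
  | inr _, inl _ => false
  end.

Fact dsum_le_refl : reflexive dsum_le.
Proof. by case=> x /=. Qed.

Fact dsum_le_anti : antisymmetric dsum_le.
Proof. by case=> x [] y //= /le_anti ->. Qed.

Fact dsum_le_trans : transitive dsum_le.
Proof. by case=> y [] x [] z //=; apply: le_trans. Qed.

HB.instance Definition _ := Order.Le_isPOrder.Build (dsum_display d1 d2)
  (P \oplus Q) dsum_le_refl dsum_le_anti dsum_le_trans.

End DirectSum.

Section ChainPartitions.
Variables (d : Order.disp_t) (P : finPOrderType d).

Definition chain (B : {set P}) : bool :=
  [forall x in B, forall y in B, x >=< y].

Definition chain_partition (C : {set {set P}}) : bool :=
  partition C [set: P] && [forall B in C, chain B].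

Definition chain_partition_type (C : {set {set P}}) : seq nat :=
  sort geq [seq #|B| | B : {set P} in C].

Definition has_chain_partition (la : seq nat) : Prop :=
  exists2 C : {set {set P}}, chain_partition C & chain_partition_type C = la.

End ChainPartitions.

Definition is_intpart (la : seq nat) : bool :=
  sorted geq la && all (leq 1) la.

(* Since [take k s] is [s] for [k] beyond its size, the partial sums are those
   of the sequences extended by zeros. *)
Definition dominated (mu nu : seq nat) : Prop :=
  sumn mu = sumn nu /\
  forall k : nat, (sumn (take k mu) <= sumn (take k nu))%N.

Definition nice d (P : finPOrderType d) : Prop :=
  forall la mu : seq nat, is_intpart la -> is_intpart mu -> dominated mu la ->
  has_chain_partition P la -> has_chain_partition P mu.

(* The order of P itself underlies a distributive lattice. *)
Definition is_distributive_lattice d (P : finPOrderType d) : Prop :=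
  exists L : finDistrLatticeType d, L = P :> finPOrderType d.

(* Main.v *)
(* The antidiagonals of the grid, preceded and followed by singletons, partition
   the poset into antichains ("layers") of sizes w_1, w_2, ..., each listed so
   that consecutive layers interlace.  The k largest blocks of a chain partition
   meet each layer in at most k elements, so a type mu dominated by the type of a
   chain partition satisfies mu_1 + ... + mu_k <= sum_i min(k, w_i).  These
   Gale-Ryser inequalities suffice for any interlacing sequence of layers, by
   greedy induction on mu: a chain of size mu_1 is formed by one element from each
   of the mu_1 largest layers, taken at the same end of all of them.  Ties are
   broken by choosing the leftmost among the layers of the critical size t; then
   the only place where interlacing could break is between the last chosen and
   the first unchosen of these, and there one of the two ends always works. *)

From HB Require Import structures.
Require Import Defs.
From mathcomp Require Import all_boot all_order.
From mathcomp Require Import zify.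

Set Implicit Arguments.
Unset Strict Implicit.
Unset Printing Implicit Defensive.

Import Order.Theory.

(** * Distributive lattice structure on the ordinal sum *)

Section DirectSumLattice.
Variables (d1 d2 : Order.disp_t).
Variables (P : finDistrLatticeType d1) (Q : finDistrLatticeType d2).

Definition dsum_meet (u v : P \oplus Q) : P \oplus Q :=
  match u, v with
  | inl x, inl y => inl (x `&` y)%O
  | inr x, inr y => inr (x `&` y)%O
  | inl x, inr _ => inl x
  | inr _, inl y => inl y
  end.

Definition dsum_join (u v : P \oplus Q) : P \oplus Q :=
  match u, v with
  | inl x, inl y => inl (x `|` y)%O
  | inr x, inr y => inr (x `|` y)%O
  | inl _, inr y => inr y
  | inr x, inl _ => inr x
  end.

Fact dsum_meetP (x y z : P \oplus Q) :
  (x <= dsum_meet y z)%O = (x <= y)%O && (x <= z)%O.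
Proof.
by case: x y z => x [] y [] z; rewrite /Order.le //= ?andbT ?andbF ?lexI.
Qed.

Fact dsum_joinP (x y z : P \oplus Q) :
  (dsum_join x y <= z)%O = (x <= z)%O && (y <= z)%O.
Proof.
by case: x y z => x [] y [] z; rewrite /Order.le //= ?andbT ?andbF ?leUx.
Qed.

HB.instance Definition _ := Order.POrder_MeetJoin_isLattice.Build _ (P \oplus Q)
  dsum_meetP dsum_joinP.

Fact dsum_meetUl : @left_distributive (P \oplus Q) _ Order.meet Order.join.
Proof.
case=> x [] y [] z; rewrite /Order.meet /Order.join /=.
(* Within one summand this is distributivity; the mixed cases need at most idempotence or
   absorption. *)
all: by rewrite ?meetUl ?joinxx ?(join_l (leIr _ _)) ?(join_r (leIr _ _)).
Qed.

HB.instance Definition _ :=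
  Order.Lattice_Meet_isDistrLattice.Build _ (P \oplus Q) dsum_meetUl.

Definition dsum_finDistrLattice : finDistrLatticeType (dsum_display d1 d2) :=
  (P \oplus Q)%type.
End DirectSumLattice.

(** * Interlacing layers and greedy extraction of chains *)

Section Layers.
Variables (T : eqType) (x0 : T) (r : rel T).
Hypothesis r_trans : transitive r.
Implicit Types (A B : seq T) (h : bool) (t : nat).

(** The two alternatives are the zigzags between a growing and a shrinking pair of antidiagonals.
    Equal sizes admit either, and trimming may turn one into the other. *)
Definition covers A B : bool :=
  [&& size A <= size B, size B <= (size A).+1 &
    [forall i : 'I_(size A), forall j : 'I_(size B),
      (i <= j <= i.+1) ==> r (nth x0 A i) (nth x0 B j)]] ||
  [&& size B <= size A, size A <= (size B).+1 &
    [forall i : 'I_(size A), forall j : 'I_(size B),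
      (j <= i <= j.+1) ==> r (nth x0 A i) (nth x0 B j)]].

Lemma coversP A B : reflect
  ([/\ size A <= size B, size B <= (size A).+1 &
     forall i j, i < size A -> j < size B -> i <= j -> j <= i.+1 ->
       r (nth x0 A i) (nth x0 B j)] \/
   [/\ size B <= size A, size A <= (size B).+1 &
     forall i j, i < size A -> j < size B -> j <= i -> i <= j.+1 ->
       r (nth x0 A i) (nth x0 B j)])
  (covers A B).
Proof.
have allP (c : rel nat) : reflect
    (forall i j, i < size A -> j < size B -> c i j -> r (nth x0 A i) (nth x0 B j))
    [forall i : 'I_(size A), forall j : 'I_(size B),
      c i j ==> r (nth x0 A i) (nth x0 B j)].
  apply: (iffP forallP) => [rAB i j iA jB cij | rAB i].
    by have /forallP/(_ (Ordinal jB))/implyP := rAB (Ordinal iA); apply.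
  by apply/forallP=> j; apply/implyP; apply: rAB.
have upP := allP (fun i j => i <= j <= i.+1).
have downP := allP (fun i j => j <= i <= j.+1).
apply: (iffP orP) => [] [].
- case/and3P=> s1 s2 /upP AB; left; split=> // i j iA jB ij ji.
  by apply: AB => //; rewrite ij.
- case/and3P=> s1 s2 /downP AB; right; split=> // i j iA jB ij ji.
  by apply: AB => //; rewrite ij.
- case=> s1 s2 AB; left; apply/and3P; split=> //.
  by apply/upP=> i j iA jB /andP[]; apply: AB.
- case=> s1 s2 AB; right; apply/and3P; split=> //.
  by apply/downP=> i j iA jB /andP[]; apply: AB.
Qed.

Definition extremity h A := nth x0 A (if h then 0 else (size A).-1).
Definition peel h A := if h then behead A else take (size A).-1 A.
Definition trim h t A := if t <= size A then peel h A else A.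

Lemma size_peel h A : size (peel h A) = (size A).-1.
Proof.
by case: h; rewrite /= ?size_behead // size_take; case: (size A) => //= k; rewrite ltnSn.
Qed.

Lemma size_trim h t A : size (trim h t A) = size A - (t <= size A).
Proof. by rewrite /trim; case: ifP; rewrite ?size_peel ?subn1 ?subn0. Qed.

Lemma nth_trim h t A i : i < size (trim h t A) ->
  nth x0 (trim h t A) i = nth x0 A ((h && (t <= size A)) + i).
Proof.
rewrite size_trim /trim; case: ifP => tA; last by rewrite andbF.
by case: h => ltiA; rewrite /peel ?nth_behead // nth_take //; lia.
Qed.

Lemma covers_extremity h A B : 0 < size A -> 0 < size B -> covers A B ->
  r (extremity h A) (extremity h B).
Proof.
by move=> A0 B0 /coversP[] [s1 s2 AB]; rewrite /extremity; case: h; apply: AB; lia.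
Qed.

Ltac solve_covers_trim AB :=
  solve [split; rewrite ?size_trim; [lia | lia | move=> *];
    rewrite !nth_trim; [apply: AB; lia | rewrite size_trim; lia ..]].

(** Trimming both lists at the same end shifts their indices alike. If only one is trimmed, the
    sizes become equal, and which pattern then holds depends on [h]. *)
Lemma covers_trim h t A B :
  0 < t -> covers A B -> covers (trim h t A) (trim h t B).
Proof.
move=> t0 /coversP AB; have [tA|tA] := leqP t (size A);
have [tB|tB] := leqP t (size B); case: h; case: AB => -[s1 s2 AB];
by apply/coversP; first [left; solve_covers_trim AB | right; solve_covers_trim AB].
Qed.

(* The side [h] is only constrained when both layers have size [t]. *)
Lemma covers_trim_junction t A B :
  0 < t -> covers A B -> exists h, covers (trim h t A) (trim h t.+1 B).
Proof.
move=> t0 /coversP AB; have [tA|tA] := leqP t (size A);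
have [tB|tB] := leqP t.+1 (size B); case: AB => -[s1 s2 AB];
by [ exists true; apply/coversP;
       first [left; solve_covers_trim AB | right; solve_covers_trim AB]
   | exists false; apply/coversP;
       first [left; solve_covers_trim AB | right; solve_covers_trim AB]].
Qed.

Implicit Types (L : bool * seq T) (ll : seq (bool * seq T)).

(* An exhausted layer [(false, [:: z])] keeps [z] as a ghost, so that its two
   neighbours remain comparable through [z]. *)
Definition level L := if L.1 then size L.2 else 0.
Definition content L := if L.1 then L.2 else [::].
Definition wf_layer L := (0 < size L.2) && (L.1 || (size L.2 == 1)).

(** The threshold [maxn t 2] never empties a list. When [t = 1], a singleton is used up by clearing
    its flag, which leaves it as a ghost. *)
Definition cut h t L :=
  (L.1 && ~~ ((t <= 1) && (size L.2 == 1)), trim h (maxn t 2) L.2).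
Definition picked h t L := nseq (t <= level L) (extremity h L.2).

Lemma level_cut h t L : 0 < t -> wf_layer L ->
  level (cut h t L) = level L - (t <= level L).
Proof.
case: L => -[] A; rewrite /level /wf_layer /= => t0; last by [].
by rewrite size_trim; case: ifP; lia.
Qed.

Lemma wf_cut h t L : wf_layer L -> wf_layer (cut h t L).
Proof. by case: L => -[] A; rewrite /wf_layer /= size_trim; lia. Qed.

Lemma perm_content_cut h t L : 0 < t -> wf_layer L ->
  perm_eq (content L) (picked h t L ++ content (cut h t L)).
Proof.
case: L => -[] A; rewrite /content /picked /level /wf_layer /= => t0;
  last by rewrite (leqNgt t) t0.
rewrite andbT /trim; have [tA|tA] := leqP t (size A); last first.
  move=> A0; rewrite /= ifT; last by lia.
  by rewrite ifF //; lia.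
(* Either the extremity really leaves the list, or [t = 1] and a singleton becomes a ghost. *)
case: ifP => sA A0 /=.
  rewrite ifT; last by lia.
  rewrite /extremity /peel; case: h; first by case: (A) A0.
  case/lastP: A {sA tA} A0 => // A x _; rewrite size_rcons /= nth_rcons ltnn eqxx.
  by rewrite -cats1 take_size_cat // perm_catC.
by case: A A0 tA sA => [|x [|y A]] //= _ tA; rewrite /extremity; case: h => //=; lia.
Qed.

Lemma perm_content_cuts h t ll : 0 < t -> all wf_layer ll ->
  perm_eq (flatten (map content ll))
    (flatten (map (picked h t) ll) ++ flatten (map content (map (cut h t) ll))).
Proof.
move=> t0; elim: ll => //= L ll IH /andP[wL /IH {}IH].
rewrite perm_sym perm_catACA perm_sym.
by apply: perm_cat; rewrite ?perm_content_cut.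
Qed.

Lemma size_picked h t ll :
  size (flatten (map (picked h t) ll)) = \sum_(L <- ll) (t <= level L).
Proof.
by elim: ll => [|L ll IH] /=; rewrite ?big_nil ?big_cons // size_cat size_nseq IH.
Qed.

Lemma subseq_picked h t ll :
  subseq (flatten (map (picked h t) ll)) [seq extremity h L.2 | L <- ll].
Proof.
elim: ll => //= L ll IH; rewrite /picked; case: (t <= _) => /=; first by rewrite eqxx.
exact: subseq_trans IH (subseq_cons _ _).
Qed.

(** All layers take part, ghosts included, so any selection of layers yields a chain by
    transitivity. *)
Lemma sorted_extremity h ll : all wf_layer ll ->
  sorted (relpre snd covers) ll -> sorted r [seq extremity h L.2 | L <- ll].
Proof.
apply: (homo_sorted_in (P := wf_layer)) => L M /andP[L0 _] /andP[M0 _].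
exact: covers_extremity.
Qed.

Lemma sorted_cut h t ll :
  sorted (relpre snd covers) ll -> sorted (relpre snd covers) (map (cut h t) ll).
Proof. by apply: homo_sorted => L M /=; apply: covers_trim; lia. Qed.

(** Each half stays interlaced for either value of [h]; only the junction between the halves
    dictates the side. *)
Lemma sorted_cut_cat t l1 l2 : 0 < t -> sorted (relpre snd covers) (l1 ++ l2) ->
  exists h, sorted (relpre snd covers) (map (cut h t) l1 ++ map (cut h t.+1) l2).
Proof.
move=> t0 s12; have [s1 s2] := cat_sorted2 s12.
case/lastP: l1 s12 s1 => [|l1 L] s12 s1; first by exists true; apply: sorted_cut.
case: l2 s12 s2 => [|M l2] s12 s2; first by exists true; rewrite cats0; apply: sorted_cut.
have LM : covers L.2 M.2.
  by move: s12; rewrite cat_rcons sorted_cat_cons => /andP[_ /andP[]].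
have [h cLM] : exists h,
      covers (trim h (maxn t 2) L.2) (trim h (maxn t.+1 2) M.2).
  (* For [t = 1] both effective thresholds are [2], so the junction is an ordinary uniform trim. *)
  have [t1|t1] := leqP t 1; last first.
    have [-> ->] : maxn t 2 = t /\ maxn t.+1 2 = t.+1 by lia.
    exact: covers_trim_junction.
  have [-> ->] : maxn t 2 = 2 /\ maxn t.+1 2 = 2 by lia.
  by exists true; apply: covers_trim.
exists h; rewrite map_rcons cat_rcons sorted_cat_cons -map_rcons sorted_cut //=.
by apply/andP; split=> //; apply: (@sorted_cut h t.+1 (M :: l2)).
Qed.

(** One greedy step: [s] is the extracted chain and [ll] the remaining layers. A layer of critical
    level [t] is used exactly when it lies in [l1]. *)
Lemma extract_chain t l1 l2 : 0 < t -> all wf_layer (l1 ++ l2) ->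
  sorted (relpre snd covers) (l1 ++ l2) ->
  exists s ll, [/\ all wf_layer ll, sorted (relpre snd covers) ll, sorted r s,
    perm_eq (flatten (map content (l1 ++ l2))) (s ++ flatten (map content ll)) &
    size s = \sum_(L <- l1) (t <= level L) + \sum_(L <- l2) (t < level L) /\
    map level ll = [seq level L - (t <= level L) | L <- l1] ++
                   [seq level L - (t < level L) | L <- l2]].
Proof.
move=> t0 w12 s12; have [h s12'] := sorted_cut_cat t0 s12.
have sx := sorted_extremity h w12 s12.
move: w12; rewrite all_cat => /andP[w1 w2].
exists (flatten (map (picked h t) l1) ++ flatten (map (picked h t.+1) l2)).
exists (map (cut h t) l1 ++ map (cut h t.+1) l2); split=> //.
- rewrite all_cat !all_map; apply/andP.
  by split; [apply: sub_all w1 | apply: sub_all w2] => L; apply: wf_cut.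
- apply: (subseq_sorted r_trans) sx.
  by rewrite map_cat; apply: cat_subseq; apply: subseq_picked.
- rewrite !map_cat !flatten_cat perm_sym perm_catACA perm_sym.
  by apply: perm_cat; apply: perm_content_cuts.
rewrite size_cat !size_picked map_cat -!map_comp; split=> //.
by congr (_ ++ _); apply/eq_in_map=> L Ll /=; apply: level_cut => //;
  [apply: (allP w1) | apply: (allP w2)].
Qed.

Lemma exists_threshold (w : seq nat) a : a <= count (leq 1) w ->
  exists2 t, 0 < t & count (leq t.+1) w <= a <= count (leq t) w.
Proof.
(* The search starts at threshold [2]: if it stops at once, [a1] gives the upper bound for [t = 1];
   otherwise minimality does. *)
move=> a1; have ex_t : exists t, count (leq t.+2) w <= a.
  (* No entry of [w] exceeds the sum of all entries. *)
  exists (sumn w); rewrite (_ : count _ _ = 0) //; apply/eqP.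
  rewrite -leqn0 leqNgt -has_count.
  apply/hasPn => x /(nthP 0)[i iw <-]; rewrite -ltnNge ltnS leqW //.
  elim: w i iw {a1} => //= y w IH [|i] /=; rewrite ?leq_addr // => /IH/leq_trans.
  by apply; rewrite leq_addl.
case: (ex_minnP ex_t) => -[|t] ta t_min; first by exists 1 => //; rewrite ta.
exists t.+2 => //; rewrite ta /= ltnW // ltnNge; apply/negP=> /t_min.
by rewrite ltnn.
Qed.

(** Discrete continuity: as [j] grows, the mixed count climbs from the lower to the upper bound in
    steps of at most one. *)
Lemma exists_split (w : seq nat) t a :
  count (leq t.+1) w <= a <= count (leq t) w ->
  exists j, count (leq t) (take j w) + count (leq t.+1) (drop j w) = a.
Proof.
elim: w a => [|x w IH] a; first by move=> aw; exists 0; move: aw => /=; lia.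
have [<- _|neq] := eqVneq (count (leq t.+1) (x :: w)) a; first by exists 0.
move=> aw; have [|j ja] := IH (a - (t <= x)); first by move: aw neq => /=; lia.
by exists j.+1 => /=; move: aw neq => /=; lia.
Qed.

(** Only entries above [k] are lowered, and they remain at least [k], so truncation at [k] hides the
    change. *)
Lemma sum_minn_cut_lt (w1 w2 : seq nat) t k : k < t ->
  \sum_(x <- [seq x - (t <= x) | x <- w1] ++ [seq x - (t < x) | x <- w2]) minn k x =
  \sum_(x <- w1 ++ w2) minn k x.
Proof.
move=> kt; elim: w1 => [|x w1 IH]; first elim: w2 => [|x w2 /= IH].
- by rewrite !big_nil.
- by rewrite /= !big_cons /= {}IH; congr (_ + _); lia.
- by rewrite /= !big_cons /= {}IH; congr (_ + _); lia.
Qed.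

Lemma sum_minn_cut_ge (w1 w2 : seq nat) t k : 0 < t <= k ->
  \sum_(x <- [seq x - (t <= x) | x <- w1] ++ [seq x - (t < x) | x <- w2]) minn k x
    + (count (leq t) w1 + count (leq t.+1) w2) =
  \sum_(x <- w1 ++ w2) minn k.+1 x.
Proof.
move=> tk; elim: w1 => [|x w1 IH]; first elim: w2 => [|x w2 /= IH].
- by rewrite !big_nil.
- by rewrite /= !big_cons -{}IH /=; move: (bigop _ _ _); lia.
- by rewrite /= !big_cons -{}IH /=; move: (bigop _ _ _); lia.
Qed.

Lemma sumn_take_behead a (s : seq nat) k :
  path geq a s -> sumn (take k s) <= sumn (take k (a :: s)).
Proof.
elim: s a k => [|b s IH] a [|k] //= /andP[ba /IH bs].
by rewrite -[b + sumn (take k s)]/(sumn (take k.+1 (b :: s))) leq_add.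
Qed.

Lemma size_content ll : size (flatten (map content ll)) = \sum_(L <- ll) level L.
Proof.
rewrite size_flatten /shape -map_comp sumnE big_map.
by apply: eq_bigr => -[[] A].
Qed.

(** The inequalities survive one greedy step. For [k < t] the truncated sums are unchanged, while
    dropping the largest part of [mu] does not raise its partial sums; for [t <= k] the inequality
    at [k.+1] loses [a] on both sides. *)
Lemma layers_chains (mu : seq nat) ll :
  sorted geq mu -> all wf_layer ll -> sorted (relpre snd covers) ll ->
  (forall k, sumn (take k mu) <= \sum_(L <- ll) minn k (level L)) ->
  sumn mu = \sum_(L <- ll) level L ->
  exists cc, [/\ map size cc = mu, all (sorted r) cc &
    perm_eq (flatten cc) (flatten (map content ll))].
Proof.
elim: mu ll => [|a mu IH] ll mu_sorted wl sl mu_le mu_eq.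
  exists [::]; split=> //; rewrite perm_sym; apply/perm_nilP/nilP.
  by rewrite /nilp size_content -mu_eq.
pose w := map level ll.
(* The inequality for [k = 1] says that there are at least [a] unexhausted layers. *)
have a1 : a <= count (leq 1) w.
  have := mu_le 1; rewrite /= take0 addn0 => /leq_trans; apply.
  rewrite /w; elim: (ll) => [|L ll' IH']; rewrite ?big_nil ?big_cons //=.
  by apply: leq_add => //; lia.
have [t t0 /exists_split[j ja]] := exists_threshold a1.
have := @extract_chain t (take j ll) (drop j ll) t0.
rewrite cat_take_drop => /(_ wl sl)[s [ll' [wl' sl' ss perm_s [size_s lev]]]].
have level_cat : map level ll' = [seq x - (t <= x) | x <- take j w] ++
    [seq x - (t < x) | x <- drop j w].
  by rewrite lev /w -map_take -map_drop -!map_comp.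
have sum_lev k : k < t ->
    \sum_(L <- ll') minn k (level L) = \sum_(L <- ll) minn k (level L).
  move=> kt; rewrite -(big_map level predT (minn k)) level_cat sum_minn_cut_lt //.
  by rewrite cat_take_drop big_map.
have sum_lev' k : t <= k ->
    \sum_(L <- ll') minn k (level L) + a = \sum_(L <- ll) minn k.+1 (level L).
  move=> tk; rewrite -(big_map level predT (minn k)) level_cat -ja sum_minn_cut_ge ?t0 //.
  by rewrite cat_take_drop big_map.
have size_sE : size s = a.
  rewrite size_s -ja -map_take -map_drop !count_map -!sum1_count /=.
  by congr (_ + _); rewrite [RHS]big_mkcond; apply: eq_bigr => L _; case: leq.
have [k||cc [cc_mu cc_r cc_s]] := IH ll' (path_sorted mu_sorted) wl' sl'.
- have [kt|tk] := ltnP k t.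
    by rewrite sum_lev // (leq_trans (sumn_take_behead _ mu_sorted)).
  by rewrite -(leq_add2r a) sum_lev' // addnC; apply: (mu_le k.+1).
- have /perm_size := perm_s; rewrite size_cat size_sE.
  by rewrite !size_content -mu_eq /= => /addnI.
exists (s :: cc); split; rewrite /= ?size_sE ?cc_mu ?ss //.
by rewrite perm_sym (perm_trans perm_s) // perm_cat2l perm_sym.
Qed.

End Layers.

(** * Duplicate-free concatenations *)

Lemma count_le1 (T : eqType) (p : pred T) (s : seq T) : uniq s ->
  {in s &, forall x y, p x -> p y -> x = y} -> count p s <= 1.
Proof.
move=> s_uniq p_eq; rewrite -size_filter.
case Efs : (filter p s) (filter_uniq p s_uniq) => [|x [|y fs]] //=.
have inE' z : (z \in filter p s) = p z && (z \in s) by exact: mem_filter.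
have /andP[px xs] : p x && (x \in s) by rewrite -inE' Efs mem_head.
have /andP[py ys] : p y && (y \in s) by rewrite -inE' Efs !inE eqxx orbT.
by rewrite (p_eq x y) // mem_head.
Qed.

Lemma uniq_flatten_mem (T : eqType) (ss : seq (seq T)) x s1 s2 :
  uniq (flatten ss) -> s1 \in ss -> s2 \in ss -> x \in s1 -> x \in s2 -> s1 = s2.
Proof.
elim: ss => //= s ss IH; rewrite cat_uniq => /and3P[_ /hasPn ssN /IH {}IH].
have notin s' : x \in s -> s' \in ss -> x \in s' -> False.
  move=> xs s's xs'; have /ssN/negP : x \in flatten ss by apply/flattenP; exists s'.
  exact.
rewrite !inE => /orP[/eqP->|s1s] /orP[/eqP->|s2s] // x1 x2; last exact: IH.
  by case: (notin s2).
by case: (notin s1).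
Qed.

Lemma uniq_flatten_uniq (T : eqType) (ss : seq (seq T)) s :
  uniq (flatten ss) -> s \in ss -> uniq s.
Proof.
elim: ss => //= s' ss IH; rewrite cat_uniq inE => /and3P[s'_uniq _ ss_uniq].
by case/orP=> [/eqP-> | /(IH ss_uniq)].
Qed.

Lemma uniq_flatten_fibers (I T : eqType) (rank : T -> I) (F : I -> seq T) (s : seq I) :
  uniq s -> {in s, forall i, uniq (F i)} ->
  (forall i x, i \in s -> x \in F i -> rank x = i) -> uniq (flatten (map F s)).
Proof.
elim: s => //= i s IH /andP[is_ s_uniq] F_uniq rankF.
have tl j : j \in s -> j \in i :: s by rewrite inE orbC => ->.
rewrite cat_uniq F_uniq ?mem_head // IH // ?andbT => [|j js|j x js xj].
- apply/hasPn => x /flatten_mapP[j js xj]; apply: contra is_ => xi.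
  by rewrite -(rankF i x (mem_head _ _) xi) (rankF j x (tl j js) xj).
- by apply: F_uniq; apply: tl.
- by apply: rankF xj; apply: tl.
Qed.

(** * From interlacing antichain layers to niceness *)

Section Layering.
Variables (d : Order.disp_t) (P : finPOrderType d).
Implicit Types (A : seq P) (ll : seq (seq P)).

(** The default [x0] of [covers] is quantified inside because the poset may be empty, as the outer
    chains can be. *)
Definition layering ll : Prop :=
  [/\ forall x0, sorted (covers x0 <=%O) ll, all (fun A => 0 < size A) ll,
      uniq (flatten ll), forall x, x \in flatten ll &
      forall A, A \in ll -> {in A &, forall x y, (x <= y)%O -> x = y}].

Lemma chain_meets_antichain (B : {set P}) A : chain B -> uniq A ->
  {in A &, forall x y, (x <= y)%O -> x = y} -> count (mem B) A <= 1.
Proof.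
move=> /forall_inP chB A_uniq antiA; apply: count_le1 => // x y xA yA xB yB.
have /forall_inP/(_ y yB)/orP[] := chB x xB; first exact: antiA.
by move=> /antiA-> .
Qed.

(** Double counting of incidences between the [k] largest blocks and each layer: at most [k] since a
    chain meets an antichain at most once, at most the layer size since blocks are disjoint. *)
Lemma chain_partition_type_le ll la k : layering ll -> has_chain_partition P la ->
  sumn (take k la) <= \sum_(A <- ll) minn k (size A).
Proof.
move=> [_ _ ll_uniq ll_all anti].
move=> [C /andP[/and3P[_ /trivIsetP trivC _] /forall_inP chC] <-].
(* Sorting the blocks themselves makes [take k] select actual blocks. *)
rewrite /chain_partition_type sort_map; set s := sort _ _.
have s_uniq : uniq s by rewrite sort_uniq enum_uniq.
have sC B : (B \in s) = (B \in C) by rewrite mem_sort mem_enum.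
have tsC B : B \in take k s -> B \in C by move=> /mem_take; rewrite sC.
have card_count (B : {set P}) : #|B| = \sum_(A <- ll) count (mem B) A.
  rewrite -[RHS](big_map (count (mem B)) predT id) -sumnE -count_flatten -size_filter.
  rewrite -(card_uniqP (filter_uniq _ ll_uniq)); apply: eq_card => x.
  by rewrite mem_filter ll_all andbT.
rewrite -map_take sumnE big_map (eq_bigr _ (fun B _ => card_count B)) exchange_big /=.
rewrite big_seq [leqRHS]big_seq; apply: leq_sum => A All.
rewrite leq_min; apply/andP; split.
  apply: (@leq_trans (\sum_(B <- take k s) 1)).
    rewrite big_seq [leqRHS]big_seq; apply: leq_sum => B /tsC BC.
    apply: chain_meets_antichain; [exact: chC| |exact: anti].
    exact: uniq_flatten_uniq ll_uniq All.
  by rewrite sum1_size size_take_min geq_minl.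
(* Second bound: summed over the elements of [A], each of which lies in at most one selected
   block. *)
under eq_bigr => B _ do rewrite -sum1_count big_mkcond /=.
rewrite exchange_big -sum1_size; apply: leq_sum => x _.
rewrite -big_mkcond sum1_count /=; apply: count_le1; first exact: take_uniq.
move=> B1 B2 /tsC B1C /tsC B2C xB1 xB2; apply/eqP/idPn => /(trivC _ _ B1C B2C).
by move=> /disjoint_setI0/setP/(_ x); rewrite !inE xB1 xB2.
Qed.

Lemma has_chain_partition_of_seqs (mu : seq nat) (cc : seq (seq P)) :
  is_intpart mu -> map size cc = mu -> all (sorted <=%O) cc ->
  perm_eq (flatten cc) (enum P) -> has_chain_partition P mu.
Proof.
move=> /andP[mu_sorted mu_pos] cc_mu cc_sorted cc_enum.
have cc_uniq : uniq (flatten cc) by rewrite (perm_uniq cc_enum) enum_uniq.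
have cc_pos s : s \in cc -> exists x, x \in s.
  move=> scc; have : 0 < size s by apply: (allP mu_pos); rewrite -cc_mu map_f.
  by case: s {scc} => // x s _; exists x; rewrite mem_head.
pose block (s : seq P) := [set x in s].
(* Parts of [mu] are positive, so every list is nonempty; equal blocks share an element and
   disjointness identifies the lists. *)
have block_inj : {in cc &, injective block}.
  move=> s1 s2 s1cc s2cc /setP s12; have [x x1] := cc_pos s1 s1cc.
  apply: (uniq_flatten_mem cc_uniq s1cc s2cc x1).
  by have := s12 x; rewrite !inE x1 => /esym.
have cc_uniq' : uniq cc.
  elim: (cc) cc_uniq cc_pos => //= s ss IH.
  rewrite cat_uniq => /and3P[_ /hasPn sN ss_uniq] pos.
  rewrite IH // ?andbT => [|s' s's]; last by apply: pos; rewrite inE s's orbT.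
  apply/negP=> s_ss; have [x xs] := pos s (mem_head _ _).
  have /sN/negP : x \in flatten ss by apply/flattenP; exists s.
  exact.
have blocks_uniq : uniq (map block cc) by rewrite map_inj_in_uniq.
pose C := [set X in map block cc].
have inC X : (X \in C) = (X \in map block cc) by rewrite inE.
(* Both types are weakly decreasing, so it suffices that they are permutations of each other. *)
exists C; last first.
  apply: (sorted_eq (leT := geq)) => //.
  - by move=> m n k; rewrite /geq /= => nm km; apply: leq_trans km nm.
  - by move=> m n; rewrite /geq /= => mn; apply/eqP; rewrite eqn_leq andbC.
  - by apply: sort_sorted => m n; apply: leq_total.
  rewrite /chain_partition_type perm_sort.
  apply: (@perm_trans _ [seq #|X : {set P}| | X <- map block cc]).
    apply: perm_map; apply: uniq_perm => //; first exact: enum_uniq.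
    by move=> X; rewrite mem_enum inC.
  rewrite -map_comp -cc_mu (iffLR (eq_in_map _ size _)) // => s scc /=.
  by rewrite cardsE; apply/card_uniqP; apply: uniq_flatten_uniq scc.
apply/andP; split; last first.
  apply/forall_inP => X; rewrite inC => /mapP[s scc ->].
  apply/forall_inP => x; rewrite inE => xs; apply/forall_inP => y; rewrite inE => ys.
  have := allP cc_sorted s scc => s_sorted.
  have /orP := leq_total (index x s) (index y s).
  by case=> ixy; [|rewrite comparable_sym]; apply: le_comparable;
    rewrite -(nth_index x xs) -(nth_index x ys);
    apply: (sorted_leq_nth le_trans le_refl) => //; rewrite inE index_mem.
apply/and3P; split.
- apply/eqP/setP=> x; rewrite inE; apply/bigcupP.
  have /flattenP[s scc xs] : x \in flatten cc by rewrite (perm_mem cc_enum) mem_enum.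
  by exists (block s); rewrite ?inE ?inC ?map_f.
- apply/trivIsetP => X Y; rewrite !inC => /mapP[s1 s1c ->] /mapP[s2 s2c ->] neq.
  apply/pred0P => x /=; rewrite !inE; apply/negP => /andP[x1 x2].
  by rewrite (uniq_flatten_mem cc_uniq s1c s2c x1 x2) eqxx in neq.
- rewrite inC; apply/mapP => -[s scc /setP s0]; have [x xs] := cc_pos s scc.
  by have := s0 x; rewrite !inE xs.
Qed.

Lemma sumn_chain_partition (la : seq nat) :
  has_chain_partition P la -> sumn la = #|P|.
Proof.
case=> C /andP[partC _] <-; rewrite -cardsT (card_partition partC).
rewrite /chain_partition_type sumnE (perm_big _ (permEl (perm_sort _ _))) /=.
by rewrite big_map big_enum.
Qed.

(** Dominance carries the necessary inequalities from [la] to [mu], for which they are also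
    sufficient. *)
Lemma nice_of_layering (x0 : P) ll : layering ll -> nice P.
Proof.
move=> lay la mu la_part mu_part [mu_la mu_le] la_chain.
have [s_ll pos_ll uniq_ll all_ll anti] := lay.
have perm_ll : perm_eq (flatten ll) (enum P).
  by apply: uniq_perm; rewrite ?enum_uniq // => x; rewrite mem_enum all_ll.
pose ll' := [seq (true, A) | A <- ll].
have content_ll : map (@content P) ll' = ll by rewrite -map_comp map_id.
have [|||k||cc [cc_mu cc_sorted cc_ll]] := @layers_chains P x0 <=%O le_trans mu ll'.
- by case/andP: mu_part.
- by rewrite all_map; apply: sub_all pos_ll => A /= A0; rewrite /wf_layer /= andbT.
- by rewrite sorted_map; apply: s_ll.
- apply: leq_trans (mu_le k) _; rewrite big_map.
  exact: chain_partition_type_le lay la_chain.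
- rewrite mu_la (sumn_chain_partition la_chain) -size_content content_ll.
  by rewrite (perm_size perm_ll) cardE.
apply: (has_chain_partition_of_seqs mu_part cc_mu cc_sorted).
by rewrite (perm_trans cc_ll) // content_ll.
Qed.
End Layering.

(** * Layerings of ordinal sums, chains and grids *)

Lemma covers_map (T T' : eqType) (f : T -> T') (r : rel T) (r' : rel T') x0 y0 A B :
  {homo f : x y / r x y >-> r' x y} ->
  covers x0 r A B -> covers y0 r' (map f A) (map f B).
Proof.
move=> f_homo /coversP AB; apply/coversP; rewrite !size_map.
by case: AB => -[s1 s2 AB]; [left | right]; split=> // i j iA jB *;
  rewrite !(nth_map x0) //; apply: f_homo; apply: AB.
Qed.

Section LayeringDsum.
Variables (d1 d2 : Order.disp_t) (P : finPOrderType d1) (Q : finPOrderType d2).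

(** Where the summands meet, both layers are singletons and interlace trivially. The default [[::]]
    covers an empty summand. *)
Lemma layering_dsum (l1 : seq (seq P)) (l2 : seq (seq Q)) :
  layering l1 -> layering l2 ->
  size (last [::] l1) <= 1 -> size (head [::] l2) <= 1 ->
  layering ([seq map inl A | A <- l1] ++ [seq map inr A | A <- l2]
            : seq (seq (P \oplus Q))).
Proof.
move=> [s1 p1 u1 a1 t1] [s2 p2 u2 a2 t2] e1 e2.
have fl : flatten [seq [seq (inl x : P \oplus Q) | x <- A] | A <- l1] =
    map inl (flatten l1).
  by rewrite map_flatten.
have fr : flatten [seq [seq (inr x : P \oplus Q) | x <- A] | A <- l2] =
    map inr (flatten l2).
  by rewrite map_flatten.
split.
- move=> x0.
  have sl : sorted (covers x0 <=%O) [seq [seq (inl x : P \oplus Q) | x <- A] | A <- l1].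
    (* The first layer, being nonempty, supplies the default element of [P]. *)
    case: l1 s1 p1 {u1 a1 t1 e1 fl} => [|[|y0 A] l1] // s1 _.
    by apply: homo_sorted (s1 y0) => X Y; apply: covers_map.
  have sr : sorted (covers x0 <=%O) [seq [seq (inr x : P \oplus Q) | x <- A] | A <- l2].
    case: l2 s2 p2 {u2 a2 t2 e2 fr} => [|[|y0 A] l2] // s2 _.
    by apply: homo_sorted (s2 y0) => X Y; apply: covers_map.
  case/lastP: l1 e1 p1 {s1 u1 a1 t1 fl} sl => [|l1 A] //=.
  rewrite last_rcons all_rcons => A1 /andP[A0 _].
  case: l2 e2 p2 {s2 u2 a2 t2 fr} sr => [|B l2] /=; first by rewrite cats0.
  move=> B1 /andP[B0 _] sr; rewrite map_rcons cat_rcons sorted_cat_cons /= => ->.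
  rewrite sr andbT; apply/coversP; left; rewrite !size_map; split; [lia | lia |].
  move=> i j iA jB _ _; rewrite -(size_map (inl : P -> P \oplus Q)) in iA.
  rewrite -(size_map (inr : Q -> P \oplus Q)) in jB.
  by have /mapP[x _ ->] := mem_nth x0 iA; have /mapP[y _ ->] := mem_nth x0 jB.
- rewrite all_cat !all_map; apply/andP.
  by split; [apply: sub_all p1 | apply: sub_all p2] => A /=; rewrite size_map.
- rewrite flatten_cat fl fr cat_uniq !map_inj_uniq ?u1 ?u2 //; try by move=> ? ? [].
  by rewrite andbT; apply/hasPn => z /mapP[x _ ->]; apply/mapP=> -[].
- by case=> x; rewrite flatten_cat fl fr mem_cat ?map_f ?orbT.
move=> A; rewrite mem_cat => /orP[] /mapP[X Xl ->] u v.
all: move=> /mapP[x xX ->] /mapP[y yX ->] xy.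
  by rewrite (t1 X Xl x y).
by rewrite (t2 X Xl x y).
Qed.
End LayeringDsum.

Lemma layering_ord p : layering [seq [:: i] | i <- enum 'I_p].
Proof.
have flat : flatten [seq [:: i] | i <- enum 'I_p] = enum 'I_p.
  by elim: (enum _) => //= i s ->.
split; rewrite ?flat ?enum_uniq //.
- move=> x0; have : sorted <=%O (enum 'I_p).
    by have := iota_sorted 0 p; rewrite -val_enum_ord sorted_map.
  apply: homo_sorted => i j ij; apply/coversP; left; split=> //.
  by move=> [|k] // [|l].
- by rewrite all_map; apply/allP.
- by move=> i; rewrite mem_enum.
by move=> A /mapP[i _ ->] x y; rewrite !inE => /eqP-> /eqP->.
Qed.

Section Grid.
Variables m n : nat.
Local Notation grid := ('I_m.+1 *p 'I_n.+1)%type.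

(** The antidiagonal of rank [k], by increasing first coordinate: this runs from the truncated
    difference [k - n] to [minn k m]. *)
Definition grid_layer (k : nat) : seq grid :=
  mkseq (fun i => (inord (k - n + i), inord (k - (k - n + i))) : grid)
    (minn k m - (k - n)).+1.

Lemma nth_grid_layer x0 k i : k <= m + n -> i < size (grid_layer k) ->
  let x := nth x0 (grid_layer k) i in
  x.1 = k - n + i :> nat /\ x.2 = k - (k - n + i) :> nat.
Proof.
rewrite size_mkseq => kmn ik; rewrite nth_mkseq //=.
by split; rewrite inordK //; lia.
Qed.

Lemma rank_grid_layer k x : k <= m + n -> x \in grid_layer k -> x.1 + x.2 = k.
Proof.
move=> kmn /(nthP x)[i ik <-]; have [-> ->] := nth_grid_layer x kmn ik.
by move: ik; rewrite size_mkseq; lia.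
Qed.

Lemma covers_grid_layer x0 k : k < m + n ->
  covers x0 <=%O (grid_layer k) (grid_layer k.+1).
Proof.
move=> kmn.
have le_step i j : i < size (grid_layer k) -> j < size (grid_layer k.+1) ->
    k - n + i <= k.+1 - n + j <= (k - n + i).+1 ->
    (nth x0 (grid_layer k) i <= nth x0 (grid_layer k.+1) j)%O.
  move=> ik jk ij; have [xi yi] := nth_grid_layer x0 (ltnW kmn) ik.
  have [xj yj] := nth_grid_layer x0 kmn jk.
  by rewrite leEprod !leEord /= xi yi xj yj; lia.
(* For [k < n] both layers start at first coordinate [0]; from [k = n] on the start advances by one,
   which reverses the index shift. *)
apply/coversP; have [kn|kn] := ltnP k n; [left | right];
  split=> [| |i j ik jk *]; try by rewrite !size_mkseq; lia.
- by apply: le_step => //; lia.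
- by apply: le_step => //; lia.
Qed.

Lemma layering_grid : layering [seq grid_layer k | k <- iota 0 (m + n).+1].
Proof.
have kmn k : k \in iota 0 (m + n).+1 -> k <= m + n by rewrite mem_iota.
split.
- move=> x0; rewrite sorted_map; apply/(sortedP 0) => k; rewrite size_iota => k_lt.
  rewrite !nth_iota ?(ltnW k_lt) //; exact: covers_grid_layer.
- by rewrite all_map; apply/allP.
- apply: (@uniq_flatten_fibers _ _ (fun x : grid => x.1 + x.2)).
  + exact: iota_uniq.
  + move=> k /kmn kk; apply/(uniqP (ord0, ord0)) => i j; rewrite !inE => ik jk eq_ij.
    have [xi _] := nth_grid_layer (ord0, ord0) kk ik.
    have [xj _] := nth_grid_layer (ord0, ord0) kk jk.
    by move: xi; rewrite eq_ij xj => /addnI.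
  + by move=> k x /kmn; apply: rank_grid_layer.
- case=> a b; have [am bn] := (ltn_ord a, ltn_ord b).
  apply/flatten_mapP; exists (a + b); first by rewrite mem_iota; lia.
  have ik : a - (a + b - n) < size (grid_layer (a + b)) by rewrite size_mkseq; lia.
  apply/(nthP (a, b)); exists (a - (a + b - n)) => //.
  have kab : a + b <= m + n by lia.
  have := nth_grid_layer (a, b) kab ik; case: (nth _ _ _) => c e /= [ca eb].
  by congr (_, _); apply: val_inj => /=; lia.
(* Comparable elements with the same coordinate sum coincide. *)
move=> A /mapP[k /kmn kk ->] [a b] [c e].
move=> /(rank_grid_layer kk) /= xk /(rank_grid_layer kk) /= yk.
rewrite leEprod !leEord /= => /andP[ac be].
by congr (_, _); apply: val_inj => /=; lia.
Qed.
End Grid.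

Theorem theorem4p5 (p q m n : nat) (m_gt0 : (0 < m)%N) (n_gt0 : (0 < n)%N) :
  nice ('I_p \oplus ('I_m *p 'I_n) \oplus 'I_q)%type /\
  is_distributive_lattice ('I_p \oplus ('I_m *p 'I_n) \oplus 'I_q)%type.
Proof.
split; last first.
  by exists (dsum_finDistrLattice (dsum_finDistrLattice 'I_p ('I_m *p 'I_n)) 'I_q).
case: m n m_gt0 n_gt0 => // m [] // n _ _.
pose x0 : ('I_p \oplus ('I_m.+1 *p 'I_n.+1) \oplus 'I_q)%type := inl (inr (ord0, ord0)).
have lay_p_grid := layering_dsum (layering_ord p) (layering_grid m n).
apply: (nice_of_layering x0 (layering_dsum (lay_p_grid _ _) (layering_ord q) _ _)).
- by case/lastP: (enum 'I_p) => [|s i] //; rewrite map_rcons last_rcons.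
- by rewrite /= size_map size_iota; lia.
(* Splitting off the last index of [iota] exposes the top antidiagonal, of rank [m + n], which has
   one element. *)
- rewrite last_cat -(addn1 (m + n)) iotaD !map_cat last_cat /= !size_map size_iota.
  lia.
- by case: (enum 'I_q).
Qed.
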